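(* Let $k\in\mathbb{N}^*$. For every finite Borel measure $\mu$ on $[0,1]^2$, the supremum in the definition of $\widetilde{\mathrm{LIS}}_k(\mu)$ is attained. Moreover the function $\widetilde{\mathrm{LIS}}_k$ is upper semi-continuous on the space of Borel probability measures on $[0,1]^2$, i.e. for any sequence $(\mu_n)_{n\in\mathbb{N}}$ of Borel probability measures on $[0,1]^2$ converging weakly to a Borel probability measure $\mu$, one has $\limsup_{n\to\infty} \widetilde{\mathrm{LIS}}_k(\mu_n)\le \widetilde{\mathrm{LIS}}_k(\mu)$. The same two assertions hold for $\widetilde{\mathrm{LDS}}_k$.
   Context: $\mathbb{N}^*=\{1,2,\dots\}$. A subset $A\subset[0,1]^2$ is nondecreasing (resp. nonincreasing) if for all $(x_1,y_1),(x_2,y_2)\in A$, $(x_2-x_1)(y_2-y_1)\ge 0$ (resp. $\le 0$). It is $k$-nondecreasing (resp. $k$-nonincreasing) if it is a union of $k$ (not necessarily disjoint) nondecreasing (resp. nonincreasing) subsets. For a finite Borel measure $\mu$ on $[0,1]^2$, $\widetilde{\mathrm{LIS}}_k(\mu):=\sup_A \mu(A)$ where $A$ ranges over closed $k$-nondecreasing subsets of $[0,1]^2$, and $\widetilde{\mathrm{LDS}}_k(\mu):=\sup_A\mu(A)$ where $A$ ranges over closed $k$-nonincreasing subsets of $[0,1]^2$. *)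

(* Defs.v *)
From HB Require Import structures.
From mathcomp Require Import all_boot all_order all_algebra.
From mathcomp Require Import all_classical all_reals all_analysis.

Set Implicit Arguments.
Unset Strict Implicit.
Unset Printing Implicit Defensive.

Import Order.TTheory GRing.Theory Num.Theory.
Import numFieldNormedType.Exports.

Local Open Scope classical_set_scope.
Local Open Scope ring_scope.

Definition unit_square_set (R : realType) : set (R * R) :=
  `[0, 1] `*` `[0, 1].
Arguments unit_square_set : clear implicits.

Definition unit_square (R : realType) : Type := set_type (unit_square_set R).

Lemma unit_square_set00 (R : realType) : (0, 0) \in unit_square_set R.
Proof. by rewrite inE; split; rewrite /= in_itv /= lexx ler01. Qed.

                                                 
HB.instance Definition _ (R : realType) :=
  PseudoMetric.copy (unit_square R) (set_type (unit_square_set R)).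

                                                 
HB.instance Definition _ (R : realType) :=
  isPointed.Build (unit_square R) (exist _ (0, 0) (unit_square_set00 R)).

Definition borel_square (R : realType) :=
  g_sigma_algebraType (@open (unit_square R)).

Section Monotone.
Context {R : realType}.
Implicit Types (A : set (unit_square R)) (k : nat).

Definition xcoord (p : unit_square R) : R := (val p).1.
Definition ycoord (p : unit_square R) : R := (val p).2.

Definition nondecreasing_subset A : Prop :=
  forall p q, A p -> A q ->
    0 <= (xcoord q - xcoord p) * (ycoord q - ycoord p).

Definition nonincreasing_subset A : Prop :=
  forall p q, A p -> A q ->
    (xcoord q - xcoord p) * (ycoord q - ycoord p) <= 0.

Definition k_nondecreasing k A : Prop :=
  exists2 B : 'I_k -> set (unit_square R),
    forall i, nondecreasing_subset (B i) & A = \bigcup_i B i.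

Definition k_nonincreasing k A : Prop :=
  exists2 B : 'I_k -> set (unit_square R),
    forall i, nonincreasing_subset (B i) & A = \bigcup_i B i.

Definition LIS_tilde k (mu : set (borel_square R) -> \bar R) : \bar R :=
  ereal_sup [set mu A | A in [set A | closed A /\ k_nondecreasing k A]].

Definition LDS_tilde k (mu : set (borel_square R) -> \bar R) : \bar R :=
  ereal_sup [set mu A | A in [set A | closed A /\ k_nonincreasing k A]].

End Monotone.

Definition weakly_converges (R : realType)
    (mu_ : nat -> probability (borel_square R) R)
    (mu : probability (borel_square R) R) : Prop :=
  forall f : unit_square R -> R, continuous f -> bounded_fun f ->
    (\int[mu_ n]_x (f x)%:E)%E @[n --> \oo] --> (\int[mu]_x (f x)%:E)%E.

(* Main.v *)
(* Let r be a closed relation on a compact metric space. Along an ultrafilter F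
   on nat, the cluster points of F-many sets B_n form a closed set L, which is
   an r-chain when all the B_n are, and any open neighbourhood of L contains
   F-almost all the B_n. Taking the limits of the k chains of closed k-chains A_n
   thus gives a closed k-chain A, and the measure of A_n is eventually bounded by
   the integral of a continuous function equal to 1 near A and to 0 outside a
   given neighbourhood of A. Weak convergence, then shrinking the neighbourhood,
   give lim mu_n(A_n) <= mu(A). A maximizing sequence for a fixed measure yields
   the attainment; optimal sets A_n for mu_n yield the semi-continuity. *)
Require Import Defs.
From mathcomp Require Import all_boot all_order all_algebra.
From mathcomp Require Import all_classical all_reals all_analysis.
From mathcomp Require Import measurable_realfun.

Set Implicit Arguments.
Unset Strict Implicit.
Unset Printing Implicit Defensive.

Import Order.TTheory GRing.Theory Num.Theory.
Import numFieldNormedType.Exports.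

Local Open Scope classical_set_scope.
Local Open Scope ring_scope.

(** * Limits of sequences of sets along an ultrafilter *)

Section ultralimit.
Context {T : topologicalType} {I : Type} (F : set_system I).
Context {FU : UltraFilter F}.
Implicit Types (B : I -> set T) (O : set T).

(* Limit along F in the sense of Kuratowski; since F is an ultrafilter, the lower
   and upper limits agree. *)
Definition ultralimit B : set T :=
  [set x | forall U, nbhs x U -> \forall n \near F, B n `&` U !=set0].

Lemma ultralimit_closed B : closed (ultralimit B).
Proof.
move=> x clx U; rewrite nbhsE => -[V [oV Vx] VU].
have [y [By Vy]] := clx _ (open_nbhs_nbhs (conj oV Vx)).
apply: filterS (By V (open_nbhs_nbhs (conj oV Vy))) => n [z [Bz Vz]].
by exists z; split => //; exact: VU.
Qed.

(** Neighbourhoods of two limit points are each met by [F]-almost all [B n], hence both by a common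
    [B n]. This gives related pairs arbitrarily close to [(p, q)], and [r] is closed. *)
Lemma ultralimit_rel (r : T -> T -> Prop) B :
  closed [set pq : T * T | r pq.1 pq.2] ->
  (forall n p q, B n p -> B n q -> r p q) ->
  forall p q, ultralimit B p -> ultralimit B q -> r p q.
Proof.
move=> clr Br p q Bp Bq; apply: (clr (p, q)) => W [[U V] [/= pU qV] UVW].
have [n [[a [Ba Ua]] [b [Bb Vb]]]] := filter_ex (filterI (Bp U pU) (Bq V qV)).
by exists (a, b); split; [exact: Br Ba Bb | exact: UVW].
Qed.

(** By compactness it is enough to argue near each point [x]: either [x] is a limit point, and [O]
    is a neighbourhood of it, or some neighbourhood of [x] is missed by [F]-almost all [B n]. *)
Lemma ultralimit_near B O : compact [set: T] -> open O -> ultralimit B `<=` O ->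
  \forall n \near F, B n `<=` O.
Proof.
move=> /compact_near_coveringP cT oO BO.
suff : \forall n \near F, [set: T] `<=` (fun x => B n x -> O x).
  by apply: filterS => n BnO x; exact: BnO.
apply: (cT I F (fun n x => B n x -> O x)) => x _.
have [Bx|nBx] := pselect (ultralimit B x).
  exists (O, setT); first by split; [exact/open_nbhs_nbhs/(conj oO)/BO|exact: filterT].
  by move=> [y n] [].
have [U [xU nFU]] : exists U, nbhs x U /\ ~ (\forall n \near F, B n `&` U !=set0).
  apply: contrapT => nU; apply: nBx => U xU; apply: contrapT => nF.
  by apply: nU; exists U.
(* Here the ultrafilter property is essential: not meeting [U] for [F]-almost all [n] becomes
   missing [U] for [F]-almost all [n]. *)
have [//|FU'] := in_ultra_setVsetC [set n | B n `&` U !=set0] FU.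
exists (U, [set n | ~ (B n `&` U !=set0)]) => //= -[y n] [/= Uy nBU] By.
by case: nBU; exists y.
Qed.

End ultralimit.

(** * Open neighbourhoods of closed sets and Urysohn functions *)

Section thickening.
Context {R : realType} {T : pseudoMetricType R}.
Implicit Types A : set T.

(** Interiors are taken because a pseudometric [ball] need not be open. *)
Definition thickening A (n : nat) : set T :=
  \bigcup_(a in A) (ball a n.+1%:R^-1)°.

Lemma thickening_open A n : open (thickening A n).
Proof. by apply: bigcup_open => a _; exact: open_interior. Qed.

Lemma thickening_sub A n : A `<=` thickening A n.
Proof. by move=> a Aa; exists a => //; exact/nbhsx_ballx. Qed.

Lemma thickening_nonincreasing A : nonincreasing_seq (thickening A).
Proof.
move=> m n mn; apply/subsetPset => x [a Aa ax]; exists a => //.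
by apply: interiorS ax; apply: le_ball; rewrite lef_pV2 ?posrE ?ler_nat.
Qed.

Lemma bigcap_thickening A : closed A -> \bigcap_n thickening A n = A.
Proof.
move=> clA; apply/seteqP; split=> [x Ax|x Ax n _]; last exact: thickening_sub.
apply: clA => U /nbhs_ballP[e /= e0 eU].
have [n ne] : exists n, (n.+1%:R^-1 < e).
  by have /filter_ex[n] := near_infty_natSinv_lt (PosNum e0); exists n.
have [a Aa /interior_subset ax] := Ax n I; exists a; split => //.
by apply/eU/(le_ball (ltW ne))/ball_sym.
Qed.

(** Urysohn's lemma, applied to the complement of [O] and the closure of an intermediate
    neighbourhood [V] of [A]. The value 1 is needed on a whole neighbourhood of [A], since
    approximating sets come close to [A] without lying in it. *)
Lemma separating_function A O : closed A -> open O -> A `<=` O ->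
  exists f : T -> R, [/\ continuous f, forall x, 0 <= f x <= 1,
    exists U, [/\ open U, A `<=` U & forall x, U x -> f x = 1]
    & forall x, ~ O x -> f x = 0].
Proof.
move=> clA oO AO.
have [V AV VO] : filter_from (set_nbhs A) closure O.
  by apply: (@pseudometric_normal R T A clA O); apply/set_nbhsP; exists O; split.
have [U [oU AU UV]] := (set_nbhsP _ _).1 AV.
have sep : uniform_separator (~` O) (closure V).
  have /(@normal_separatorP R) := @pseudometric_normal R T; apply.
  - exact: open_closedC.
  - exact: closed_closure.
  - by apply/seteqP; split => // x [nO /VO].
have /(@uniform_separatorP _ R)[f [cf f01 f0 f1]] := sep.
exists f; split => //.
- by move=> x; have := f01 (f x) (imageT f x); rewrite /= in_itv.
- by exists U; split => // x Ux; apply: f1; exists x => //; exact/subset_closure/UV.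
- by move=> x nOx; apply: f0; exists x.
Qed.

End thickening.

(** * Comparison of measures with integrals of continuous functions *)

Section borel.
Context {R : realType} {T : pseudoPMetricType R}.
Notation borel := (g_sigma_algebraType (@open T)).
Implicit Types (A O : set T) (mu : {measure set borel -> \bar R}).

Lemma open_borel O : open O -> measurable (O : set borel).
Proof. by move=> oO; exact: sub_sigma_algebra. Qed.

Lemma closed_borel A : closed A -> measurable (A : set borel).
Proof.
move=> clA; rewrite -[A]setCK; apply: measurableC. apply: open_borel.
exact: closed_openC.
Qed.

Lemma continuous_borel (f : T -> R) : continuous f -> measurable_fun setT (f : borel -> R).
Proof.
move=> /continuousP cf; apply: (measurability _ (RGenOpens.measurableE R)) => //.
move=> _ [_ [a [b ->] <-]]; rewrite setTI; apply: open_borel; apply: cf; exact: interval_open.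
Qed.

Lemma measure_le_integral mu (A : set T) (f : T -> R) : closed A ->
  continuous f -> (forall x, 0 <= f x) -> (forall x, A x -> f x = 1) ->
  (mu A <= \int[mu]_x (f x)%:E)%E.
Proof.
move=> clA cf f0 fA; have mA := closed_borel clA.
rewrite -[A in mu A]setIT -(integral_indic mu measurableT mA).
apply: ge0_le_integral => //=.
- exact/measurable_EFinP/measurable_indic.
- by apply/measurable_EFinP; exact: continuous_borel.
- move=> x _; rewrite lee_fin indicE.
  by have [/set_mem/fA ->|] := boolP (x \in A).
Qed.

Lemma integral_le_measure mu (O : set T) (f : T -> R) : open O ->
  continuous f -> (forall x, 0 <= f x <= 1) -> (forall x, ~ O x -> f x = 0) ->
  (\int[mu]_x (f x)%:E <= mu O)%E.
Proof.
move=> oO cf f01 fO; have mO := open_borel oO.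
rewrite -[X in (_ <= mu X)%E]setIT -(integral_indic mu measurableT mO).
apply: ge0_le_integral => //=.
- by move=> x _; rewrite lee_fin; have /andP[] := f01 x.
- by apply/measurable_EFinP; exact: continuous_borel.
- exact/measurable_EFinP/measurable_indic.
- move=> x _; rewrite lee_fin indicE.
  have [_|/negP nOx] := boolP (x \in O); first by have /andP[] := f01 x.
  by rewrite fO//; move=> /mem_set.
Qed.

Lemma cvg_measure_thickening (mu : {finite_measure set borel -> \bar R}) A :
  closed A -> mu (thickening A n) @[n --> \oo] --> mu A.
Proof.
move=> clA; rewrite -[X in _ --> mu X](bigcap_thickening clA).
apply: nonincreasing_cvg_mu.
- by rewrite ltey_eq fin_num_measure//; apply: open_borel; exact: thickening_open.
- by move=> n; apply: open_borel; exact: thickening_open.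
- by rewrite bigcap_thickening//; exact: closed_borel.
- exact: thickening_nonincreasing.
Qed.

End borel.

(** * Attainment and semi-continuity for a closed relation *)

Section chains.
Context {R : realType} {T : pseudoPMetricType R}.
Notation borel := (g_sigma_algebraType (@open T)).
Variables (r : T -> T -> Prop) (k : nat).
Implicit Types A : set T.

(** An arbitrary [r] lets the nondecreasing and nonincreasing cases be two instances of one
    argument. *)
Definition kchain A : Prop :=
  exists2 B : 'I_k -> set T,
    forall i p q, B i p -> B i q -> r p q & A = \bigcup_i B i.

Definition chain_sup (mu : set borel -> \bar R) : \bar R :=
  ereal_sup [set mu A | A in [set A | closed A /\ kchain A]].

Hypothesis compactT : compact [set: T].
Hypothesis closed_r : closed [set pq : T * T | r pq.1 pq.2].

(** The lower bounds [u] serve two uses: a maximizing sequence for a constant [mu_], and a constant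
    threshold for varying measures. *)
Lemma kchain_ultralimit (F : set_system nat) {FU : UltraFilter F}
    (mu_ : nat -> {measure set borel -> \bar R})
    (mu : {finite_measure set borel -> \bar R})
    (A_ : nat -> set T) (u : nat -> \bar R) (c : \bar R) :
  (forall f : T -> R, continuous f -> bounded_fun f ->
    (\int[mu_ n]_x (f x)%:E)%E @[n --> F] --> (\int[mu]_x (f x)%:E)%E) ->
  (forall n, closed (A_ n) /\ kchain (A_ n)) ->
  (\forall n \near F, u n <= mu_ n (A_ n))%E -> u @ F --> c ->
  exists A, [/\ closed A, kchain A & (c <= mu A)%E].
Proof.
move=> mu_cvg A_P uA uc.
have [B BP] : {B : nat -> 'I_k -> set T & forall n,
    (forall i p q, B n i p -> B n i q -> r p q) /\ A_ n = \bigcup_i B n i}.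
  apply: (@choice _ _ (fun n B => (forall i p q, B i p -> B i q -> r p q) /\
     A_ n = \bigcup_i B i)) => n.
  by have [_ [B Br AB]] := A_P n; exists B.
pose L i := ultralimit F (B ^~ i); pose A := \bigcup_i L i.
have clA : closed A.
  by apply: closed_bigcup => [|i _]; [exact: finite_finset|exact: ultralimit_closed].
exists A; split => //.
  exists L => // i p q; apply: ultralimit_rel => // n x y; exact: (BP n).1.
(* It suffices to bound [c] by the measure of each thickening of [A], as these measures tend to
   [mu A]. *)
apply: (cvge_to_ge (cvg_measure_thickening (mu := mu) clA)).
near=> m.
have [f [cf f01 [U [oU AU fU]] fO]] :=
  separating_function clA (thickening_open A m) (@thickening_sub _ _ A m).
apply: le_trans (integral_le_measure mu (thickening_open A m) cf f01 fO).
have bf : bounded_fun f.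
  exists 1; split; first exact: num_real.
  move=> M M1 x _ /=; have /andP[f0 f1] := f01 x.
  by rewrite ger0_norm// (le_trans f1)// ltW.
apply: (lee_cvg_to uc (mu_cvg f cf bf)).
have AnU : \forall n \near F, forall i, B n i `<=` U.
  (* Only [k] chains are involved, so the [F]-large sets of indices may be intersected. *)
  apply: filter_forall => i; apply: ultralimit_near => //.
  by move=> x Lx; apply: AU; exists i.
near=> n.
have uAn : (u n <= mu_ n (A_ n))%E by near: n.
apply: (le_trans uAn).
apply: measure_le_integral => //; first exact: (A_P n).1.
  by move=> x; have /andP[] := f01 x.
move=> x; rewrite (BP n).2 => -[i _ Bx]; apply: fU.
have BnU : forall i, B n i `<=` U by near: n.
exact: BnU Bx.
Unshelve. all: by end_near. Qed.

Lemma kchain_set0 : kchain set0.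
Proof. by exists (fun=> set0) => //; rewrite bigcup0. Qed.

Lemma chain_sup_attained (mu : {finite_measure set borel -> \bar R}) :
  exists A, [/\ closed A, kchain A & mu A = chain_sup mu].
Proof.
have [|v vP v_cvg] := @ereal_sup_seq R
    [set mu A | A in [set A | closed A /\ kchain A]].
  apply/set0P; exists (mu set0), set0 => //.
  by split; [exact: closed0 | exact: kchain_set0].
have [A_ A_P] : {A_ : nat -> set T & forall n,
    (closed (A_ n) /\ kchain (A_ n)) /\ mu (A_ n) = v n}.
  apply: (@choice _ _ (fun n A => (closed A /\ kchain A) /\ mu A = v n)) => n.
  by have [A AP muA] := vP n; exists A.
have [F [FU ooF]] := ultraFilterLemma (F := \oo) _.
have [||||A [clA Achain muA]] :=
    @kchain_ultralimit F FU (fun=> mu) mu A_ v (chain_sup mu).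
- by move=> f _ _; exact: cvg_cst.
- by move=> n; have [] := A_P n.
- by apply: nearW => n; have [_ <-] := A_P n.
- by apply: cvg_trans v_cvg; exact: cvg_app.
exists A; split => //; apply/eqP; rewrite eq_le muA andbT.
by apply: ereal_sup_ubound; exists A.
Qed.

Lemma chain_sup_usc (mu_ : nat -> {finite_measure set borel -> \bar R})
    (mu : {finite_measure set borel -> \bar R}) :
  (forall f : T -> R, continuous f -> bounded_fun f ->
    (\int[mu_ n]_x (f x)%:E)%E @[n --> \oo] --> (\int[mu]_x (f x)%:E)%E) ->
  (limn_esup (fun n => chain_sup (mu_ n)) <= chain_sup mu)%E.
Proof.
move=> mu_cvg; apply/lee_addgt0Pr => e e0; rewrite leNgt; apply/negP => lt_sup.
pose c := (chain_sup mu + e%:E)%E.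
pose D := [set n | (c < chain_sup (mu_ n))%E].
(* If [D] were not met infinitely often, the supremum over its complement would bound the limsup by
   [c]. An ultrafilter finer than this one contains [D] and still refines [\oo]. *)
have D_frequent : ProperFilter (within D \oo).
  split; last exact: within_filter.
  move=> nD; suff : (limn_esup (fun n => chain_sup (mu_ n)) <= c)%E.
    by rewrite leNgt lt_sup.
  rewrite /limn_esup limf_esupE; apply: (@le_trans _ _ (ereal_sup ((fun n => chain_sup (mu_ n)) @` (~` D)))).
    by apply: ereal_inf_lbound; exists (~` D).
  by apply: ge_ereal_sup => _ [n nDn <-]; rewrite leNgt; exact/negP.
have [F [FU DF]] := ultraFilterLemma D_frequent.
have [A_ A_P] : {A_ : nat -> set T & forall n,
    [/\ closed (A_ n), kchain (A_ n) & mu_ n (A_ n) = chain_sup (mu_ n)]}.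
  apply: (@choice _ _ (fun n A => [/\ closed A, kchain A & mu_ n A = chain_sup (mu_ n)])) => n.
  exact: chain_sup_attained.
have [||||A [clA Achain muA]] :=
    @kchain_ultralimit F FU mu_ mu A_ (cst c) c.
- move=> f cf bf; apply: cvg_trans (mu_cvg f cf bf).
  apply: cvg_app => P ooP; apply: DF; exact: filterS ooP.
- by move=> n; have [] := A_P n.
- suff: F D.
    by apply: filterS => n /ltW Dn; have [_ _ muA] := A_P n; rewrite -muA in Dn.
  apply: DF; exact: withinT.
- exact: cvg_cst.
have : (c <= chain_sup mu)%E.
  by apply: le_trans muA _; apply: ereal_sup_ubound; exists A.
(* Attainment makes [chain_sup mu] a value of a finite measure, hence finite, so adding [e] strictly
   increases it. *)
rewrite /c; have [A' [clA' _ <-]] := chain_sup_attained mu; apply/negP.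
rewrite -ltNge lteDl ?lte_fin//.
by apply: fin_num_measure; exact: closed_borel.
Qed.

End chains.

(** * Compactness of the square and closedness of the two relations *)

Lemma set_type_compact (X : topologicalType) (K : set X) :
  compact K -> compact [set: set_type K].
Proof.
move=> cK F FF _.
have FK : F (set_val @^-1` K) by apply: filterE => -[x Kx]; exact: set_mem.
(* The image filter clusters at a point of [K]. Open sets of the subtype are traces of open sets of
   [X], so [F] clusters there too. *)
have [x [Kx clx]] := cK _ (fmap_proper_filter set_val FF) FK.
exists (exist _ x (mem_set Kx)); split => // A U FA [V [[W oW <-] /= Wx] WU].
have [y [[a Aa <-] Wa]] : (set_val @` A) `&` W !=set0.
  apply: clx; last exact: open_nbhs_nbhs.
  by apply: (@filterS _ F _ A) => // a Aa; exists a.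
by exists a; split => //; exact: WU.
Qed.

Section square.
Context {R : realType}.

Lemma unit_square_compact : compact [set: unit_square R].
Proof.
by apply: set_type_compact; apply: compact_setX; exact: segment_compact.
Qed.

Lemma continuous_xcoord : continuous (@xcoord R).
Proof.
move=> p; apply: (@continuous_comp _ _ _ _ fst); last exact: cvg_fst.
exact: initial_continuous.
Qed.

Lemma continuous_ycoord : continuous (@ycoord R).
Proof.
move=> p; apply: (@continuous_comp _ _ _ _ snd); last exact: cvg_snd.
exact: initial_continuous.
Qed.

(** The half-lines [D] of nonnegative and of nonpositive reals yield the two monotonicity
    relations. *)
Lemma closed_coord_product (D : set R) : closed D ->
  closed [set pq : unit_square R * unit_square R |
    D ((xcoord pq.2 - xcoord pq.1) * (ycoord pq.2 - ycoord pq.1))].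
Proof.
move=> clD; apply: (@closed_comp _ _ (fun pq : unit_square R * unit_square R =>
   (xcoord pq.2 - xcoord pq.1) * (ycoord pq.2 - ycoord pq.1)) D) => // pq _.
apply: cvgM; apply: cvgB.
- by apply: (@continuous_comp _ _ _ snd); [exact: cvg_snd|exact: continuous_xcoord].
- by apply: (@continuous_comp _ _ _ fst); [exact: cvg_fst|exact: continuous_xcoord].
- by apply: (@continuous_comp _ _ _ snd); [exact: cvg_snd|exact: continuous_ycoord].
- by apply: (@continuous_comp _ _ _ fst); [exact: cvg_fst|exact: continuous_ycoord].
Qed.

End square.

Theorem proposition2p1 (R : realType) (k : nat) (k_gt0 : (0 < k)%N) :
  ((forall mu : {finite_measure set (borel_square R) -> \bar R},
      exists A : set (unit_square R),
        [/\ closed A, k_nondecreasing k A & mu A = LIS_tilde k mu]) /\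
   (forall (mu_ : nat -> probability (borel_square R) R)
           (mu : probability (borel_square R) R),
      weakly_converges mu_ mu ->
      (limn_esup (fun n => LIS_tilde k (mu_ n)) <= LIS_tilde k mu)%E)) /\
  ((forall mu : {finite_measure set (borel_square R) -> \bar R},
      exists A : set (unit_square R),
        [/\ closed A, k_nonincreasing k A & mu A = LDS_tilde k mu]) /\
   (forall (mu_ : nat -> probability (borel_square R) R)
           (mu : probability (borel_square R) R),
      weakly_converges mu_ mu ->
      (limn_esup (fun n => LDS_tilde k (mu_ n)) <= LDS_tilde k mu)%E)).
Proof.
have cT := @unit_square_compact R.
have clLIS := closed_coord_product (@closed_ge R 0).
have clLDS := closed_coord_product (@closed_le R 0).
split; split.
- exact: (chain_sup_attained k cT clLIS).
- by move=> mu_ mu; exact: (@chain_sup_usc _ _ _ k cT clLIS (fun n => mu_ n) mu).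
- exact: (chain_sup_attained k cT clLDS).
- by move=> mu_ mu; exact: (@chain_sup_usc _ _ _ k cT clLDS (fun n => mu_ n) mu).
Qed.
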